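(* Let $r\ge 2$. Let $\gamma$ be a $2$-Frenet helix, with constant curvature $\kappa$ and $\epsilon_2=\langle F_2,F_2\rangle$, in an $m$-dimensional semi-Riemannian space form $N^m_t(c)$, $m\ge 3$, $1\le t\le m-1$. Then $\gamma$ is proper $r$-harmonic if and only if $$\kappa^2-\epsilon_2\,(r-1)\,c=0.$$
   Context: Conventions. For a semi-Riemannian manifold $(M,\langle\,,\rangle)$ with Levi-Civita connection $\nabla$, $R(X,Y)Z=\nabla_X\nabla_YZ-\nabla_Y\nabla_XZ-\nabla_{[X,Y]}Z$. Curves $\gamma:I\to M$ ($I$ an open real interval) are smooth, nonnull, parametrized by arc length; $T=\gamma'$, $\langle T,T\rangle=\epsilon_1\in\{1,-1\}$. Put $\nabla_T^0T=T$, $\nabla_T^jT=\nabla_T(\nabla_T^{j-1}T)$. For $r\ge2$, $\gamma$ is $r$-harmonic if $$\tau_r(\gamma)=\nabla^{2r-1}_T T+\sum_{\ell=0}^{r-2}(-1)^\ell R\big(\nabla^{2r-3-\ell}_T T,\nabla^{\ell}_T T\big)T=0,$$ and proper $r$-harmonic if it is $r$-harmonic and not a geodesic. A $2$-Frenet curve (Frenet curve of order $2$) in a manifold of dimension $m\ge3$ is a curve admitting a frame $\{F_1=T,F_2\}$ along it with $\langle F_i,F_i\rangle=\epsilon_i=\pm1$, $\langle F_1,F_2\rangle=0$, and $\nabla_TF_1=\epsilon_2kF_2$, $\nabla_TF_2=-\epsilon_1kF_1$, where the curvature $k(s)$ is a positive function. It is a helix if $k$ is constant, $k=\kappa$. Space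 forms: let $\mathbb{R}^n_t$ be $\mathbb{R}^n$ with $\langle x,y\rangle=-\sum_{i=1}^t x_iy_i+\sum_{i=t+1}^n x_iy_i$. $N^m_t(c)$ denotes $\mathbb{R}^m_t$ if $c=0$, $\{x\in\mathbb{R}^{m+1}_t:\langle x,x\rangle=1/c\}$ if $c>0$, $\{x\in\mathbb{R}^{m+1}_{t+1}:\langle x,x\rangle=1/c\}$ if $c<0$, with the induced metric of index $t$; its curvature is $R(X,Y)Z=c(\langle Y,Z\rangle X-\langle X,Z\rangle Y)$. *)

(* Defs.v *)
From HB Require Import structures.
From mathcomp Require Import all_boot all_order all_algebra.
From mathcomp Require Import all_classical all_reals all_analysis.

Set Implicit Arguments.
Unset Strict Implicit.
Unset Printing Implicit Defensive.

Import Order.TTheory GRing.Theory Num.Theory.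
Import numFieldNormedType.Exports.

Local Open Scope classical_set_scope.
Local Open Scope ring_scope.

(* <x, y> = - sum_(i < t) x_i y_i + sum_(t <= i < n) x_i y_i on R^n;
   coordinates are numbered from 0. *)
Definition semi_euclid (R : realType) (n t : nat) (x y : 'rV[R]_n) : R :=
  \sum_(i < n) (if (i < t)%N then -1 else 1) * (x ord0 i * y ord0 i).

(* N^m_t(c) lives in R^m_t if c = 0, in R^(m+1)_t if c > 0 and in
   R^(m+1)_(t+1) if c < 0. *)
Definition ambient_dim (R : realType) (m : nat) (c : R) : nat :=
  if c == 0 then m else m.+1.

Definition ambient_index (R : realType) (t : nat) (c : R) : nat :=
  if c < 0 then t.+1 else t.

Definition metric (R : realType) (m t : nat) (c : R)
    (x y : 'rV[R]_(ambient_dim m c)) : R :=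
  semi_euclid (ambient_index t c) x y.

Definition space_form (R : realType) (m t : nat) (c : R) :
    set ('rV[R]_(ambient_dim m c)) :=
  [set x | c != 0 -> metric t x x = c^-1].

(* The tangent space at p: all of R^m if c = 0, and the kernel of the
   differential of x |-> <x, x> at p otherwise. *)
Definition tangent (R : realType) (m t : nat) (c : R) (p : 'rV[R]_(ambient_dim m c)) :
    set ('rV[R]_(ambient_dim m c)) :=
  [set v | c != 0 -> metric t v p = 0].

(* Orthogonal projection of the ambient space onto the tangent space at a
   point p of the space form; see tanproj_tangent and tanproj_normal. *)
Definition tanproj (R : realType) (m t : nat) (c : R)
    (p v : 'rV[R]_(ambient_dim m c)) : 'rV[R]_(ambient_dim m c) :=
  v - (c * metric t v p) *: p.

Definition curvature (R : realType) (m t : nat) (c : R)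
    (X Y Z : 'rV[R]_(ambient_dim m c)) : 'rV[R]_(ambient_dim m c) :=
  c *: (metric t Y Z *: X - metric t X Z *: Y).

(* A curve, or a vector field along a curve, parametrized by an open interval
   I is represented by a function on R of which only the values on I matter. *)
Definition smooth_on (R : realType) (n : nat) (I : set R)
    (f : R -> 'rV[R]_n) : Prop :=
  forall (k : nat) (s : R), I s -> derivable (derive1n k f) s 1.

Definition velocity (R : realType) (m : nat) (c : R)
    (gamma : R -> 'rV[R]_(ambient_dim m c)) : R -> 'rV[R]_(ambient_dim m c) :=
  derive1 gamma.

(* Covariant derivative, along gamma, of a vector field V along gamma: the
   Levi-Civita connection of the metric induced on a nondegenerate submanifold
   of a flat space is the tangential part of the flat derivative. *)
Definition nablaT (R : realType) (m t : nat) (c : R)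
    (gamma V : R -> 'rV[R]_(ambient_dim m c)) : R -> 'rV[R]_(ambient_dim m c) :=
  fun s => tanproj t (gamma s) (derive1 V s).

Definition nablaT_iter (R : realType) (m t : nat) (c : R)
    (gamma : R -> 'rV[R]_(ambient_dim m c)) (j : nat) : R -> 'rV[R]_(ambient_dim m c) :=
  iter j (nablaT t gamma) (velocity gamma).

Definition smooth_field (R : realType) (m t : nat) (c : R) (I : set R)
    (gamma V : R -> 'rV[R]_(ambient_dim m c)) : Prop :=
  smooth_on I V /\ forall s, I s -> tangent t (gamma s) (V s).

Definition unit_speed_curve (R : realType) (m t : nat) (c : R) (I : set R)
    (gamma : R -> 'rV[R]_(ambient_dim m c)) (eps1 : R) : Prop :=
  [/\ smooth_on I gamma,
      forall s, I s -> space_form t (gamma s),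
      eps1 = 1 \/ eps1 = -1 &
      forall s, I s -> metric t (velocity gamma s) (velocity gamma s) = eps1].

Definition geodesic (R : realType) (m t : nat) (c : R) (I : set R)
    (gamma : R -> 'rV[R]_(ambient_dim m c)) : Prop :=
  forall s, I s -> nablaT t gamma (velocity gamma) s = 0.

(* Only meant for 2 <= r, where the truncated subtractions are exact. *)
Definition tau (R : realType) (m t : nat) (c : R) (r : nat)
    (gamma : R -> 'rV[R]_(ambient_dim m c)) (s : R) : 'rV[R]_(ambient_dim m c) :=
  nablaT_iter t gamma (2 * r - 1) s +
  \sum_(0 <= l < r - 1)
     (-1) ^+ l *: curvature t (nablaT_iter t gamma (2 * r - 3 - l) s)
                              (nablaT_iter t gamma l s)
                              (velocity gamma s).

Definition harmonic (R : realType) (m t : nat) (c : R) (r : nat) (I : set R)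
    (gamma : R -> 'rV[R]_(ambient_dim m c)) : Prop :=
  forall s, I s -> tau t r gamma s = 0.

Definition proper_harmonic (R : realType) (m t : nat) (c : R) (r : nat)
    (I : set R) (gamma : R -> 'rV[R]_(ambient_dim m c)) : Prop :=
  harmonic t r I gamma /\ ~ geodesic t I gamma.

(* gamma is a 2-Frenet curve with frame F1 = gamma', F2 and curvature k. *)
Definition frenet2 (R : realType) (m t : nat) (c : R) (I : set R)
    (gamma F2 : R -> 'rV[R]_(ambient_dim m c)) (eps1 eps2 : R) (k : R -> R) : Prop :=
  let F1 := velocity gamma in
  [/\ unit_speed_curve t I gamma eps1,
      smooth_field t I gamma F2,
      eps2 = 1 \/ eps2 = -1,
      (forall s, I s -> metric t (F2 s) (F2 s) = eps2 /\
                        metric t (F1 s) (F2 s) = 0) &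
      forall s, I s ->
        [/\ 0 < k s,
            nablaT t gamma F1 s = (eps2 * k s) *: F2 s &
            nablaT t gamma F2 s = - (eps1 * k s) *: F1 s]].

Definition helix2 (R : realType) (m t : nat) (c : R) (I : set R)
    (gamma F2 : R -> 'rV[R]_(ambient_dim m c)) (eps1 eps2 kappa : R) : Prop :=
  exists2 k : R -> R, frenet2 t I gamma F2 eps1 eps2 k &
                      forall s, I s -> k s = kappa.

Lemma semi_euclidC (R : realType) (n t : nat) (x y : 'rV[R]_n) :
  semi_euclid t x y = semi_euclid t y x.
Proof. by apply: eq_bigr => i _; rewrite [y _ _ * _]mulrC. Qed.

Lemma semi_euclidDl (R : realType) (n t : nat) (x y z : 'rV[R]_n) :
  semi_euclid t (x + y) z = semi_euclid t x z + semi_euclid t y z.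
Proof.
by rewrite -big_split; apply: eq_bigr => i _; rewrite !mxE mulrDl mulrDr.
Qed.

Lemma semi_euclidZl (R : realType) (n t : nat) (a : R) (x y : 'rV[R]_n) :
  semi_euclid t (a *: x) y = a * semi_euclid t x y.
Proof.
by rewrite mulr_sumr; apply: eq_bigr => i _; rewrite !mxE -mulrA mulrCA.
Qed.

Lemma tanproj_tangent (R : realType) (m t : nat) (c : R)
    (p v : 'rV[R]_(ambient_dim m c)) :
  space_form t p -> tangent t p (tanproj t p v).
Proof.
rewrite /space_form /tangent /tanproj /metric /= => Mp c0.
rewrite -scaleNr semi_euclidDl semi_euclidZl Mp //.
by rewrite mulNr mulrAC divff // mul1r subrr.
Qed.

Lemma tanproj_normal (R : realType) (m t : nat) (c : R)
    (p v w : 'rV[R]_(ambient_dim m c)) :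
  tangent t p w -> metric t (v - tanproj t p v) w = 0.
Proof.
rewrite /tangent /tanproj /metric /= => Tw.
rewrite subKr semi_euclidZl [X in _ * X]semi_euclidC.
have [c0|c0] := eqVneq c 0; last by rewrite Tw // mulr0.
by rewrite [X in X * _ * _]c0 !mul0r.
Qed.

Lemma is_derive_metric (R : realType) (m t : nat) (c : R)
    (V W : R -> 'rV[R]_(ambient_dim m c)) (s : R) :
  derivable V s 1 -> derivable W s 1 ->
  is_derive s 1 (fun u => metric t (V u) (W u))
    (metric t (derive1 V s) (W s) + metric t (V s) (derive1 W s)).
Proof.
move=> dV dW; rewrite !derive1E (derive_mx dV) (derive_mx dW) /metric /semi_euclid.
have dVi i : is_derive s 1 (fun u => V u ord0 i) ('D_1 (fun u => V u ord0 i) s).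
  by apply/derivableP; move/derivable_mxP: dV; apply.
have dWi i : is_derive s 1 (fun u => W u ord0 i) ('D_1 (fun u => W u ord0 i) s).
  by apply/derivableP; move/derivable_mxP: dW; apply.
rewrite [X in is_derive _ _ X](_ : _ = \sum_(i < ambient_dim m c)
  ((if (i < ambient_index t c)%N then -1 else 1 : R) \*:
     ((fun u => V u ord0 i) * (fun u => W u ord0 i)))); last first.
  by apply/funext => u; rewrite fct_sumE.
apply: is_derive_eq.
rewrite -big_split; apply: eq_bigr => i _; rewrite !mxE /=.
by rewrite -mulrDr addrC; congr (_ * (_ + _)); rewrite mulrC.
Qed.

(* Metric compatibility of the covariant derivative. *)
Lemma nablaT_metric (R : realType) (m t : nat) (c : R)
    (gamma V W : R -> 'rV[R]_(ambient_dim m c)) (s : R) :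
  derivable V s 1 -> derivable W s 1 ->
  tangent t (gamma s) (V s) -> tangent t (gamma s) (W s) ->
  derive1 (fun u => metric t (V u) (W u)) s =
  metric t (nablaT t gamma V s) (W s) + metric t (V s) (nablaT t gamma W s).
Proof.
move=> dV dW TV TW; have [_ dVW] := is_derive_metric t dV dW.
rewrite derive1E; apply: (etrans dVW).
have tanE (v w : 'rV[R]_(ambient_dim m c)) : tangent t (gamma s) w ->
    metric t v w = metric t (tanproj t (gamma s) v) w.
  move=> /(tanproj_normal v); rewrite /metric -scaleN1r semi_euclidDl.
  by rewrite semi_euclidZl mulN1r => /eqP; rewrite subr_eq0 => /eqP.
rewrite (tanE _ _ TW) /metric [X in _ + X]semi_euclidC.
by rewrite [X in _ + X](tanE _ _ TV) /metric [X in _ + X]semi_euclidC.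
Qed.

(* Main.v *)
(* For a helix, nabla_T acts on span(T, F2) with constant coefficients and
   nabla_T^2 T = q T, where q = - eps1 eps2 kappa^2. Hence each of the r - 1
   curvature terms of tau_r equals c eps1 eps2 kappa q^(r-2) F2: in the term of
   index l exactly one argument is a multiple of T, and the antisymmetry of the
   curvature compensates the sign (-1)^l. So tau_r is a nonzero multiple of
   (kappa^2 - eps2 (r - 1) c) F2. *)
Require Import Defs.
From mathcomp Require Import all_boot all_order all_algebra.
From mathcomp Require Import all_classical all_reals all_analysis.
From mathcomp Require Import ring zify.

Set Implicit Arguments.
Unset Strict Implicit.
Unset Printing Implicit Defensive.

Import Order.TTheory GRing.Theory Num.Theory.
Import numFieldNormedType.Exports.

Local Open Scope classical_set_scope.
Local Open Scope ring_scope.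

Lemma semi_euclid0l (R : realType) (n t : nat) (y : 'rV[R]_n) :
  semi_euclid t 0 y = 0.
Proof. by rewrite -(scale0r 0) semi_euclidZl mul0r. Qed.

(** Since [I] is open, equality on [I] is equality near each of its points, which is all a
    derivative sees. *)
Lemma eq_nablaT (R : realType) (m t : nat) (c : R) (I : set R)
    (gamma V W : R -> 'rV[R]_(ambient_dim m c)) :
  open I -> {in I, V =1 W} -> {in I, nablaT t gamma V =1 nablaT t gamma W}.
Proof.
move=> oI VW s Is; rewrite /nablaT !derive1E (@near_eq_derive _ _ _ _ W) //.
have : nbhs s I by apply: open_nbhs_nbhs; split => //; exact/set_mem.
by apply: filterS => u Iu; apply: VW; exact/mem_set.
Qed.

Lemma nablaTZ (R : realType) (m t : nat) (c : R)
    (gamma V : R -> 'rV[R]_(ambient_dim m c)) (a s : R) :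
  derivable V s 1 ->
  nablaT t gamma (fun u => a *: V u) s = a *: nablaT t gamma V s.
Proof.
move=> dV; rewrite /nablaT /tanproj /metric !derive1E deriveZ //.
by rewrite semi_euclidZl scalerBr scalerA mulrCA.
Qed.

Lemma smooth_on_derive1 (R : realType) (n : nat) (I : set R)
    (f : R -> 'rV[R]_n) (s : R) :
  smooth_on I f -> I s -> derivable (derive1 f) s 1.
Proof. by move=> /(_ 1%N s) + Is => /(_ Is). Qed.

(** Each pair of derivatives, from [T] to [F2] and back, contributes the factor
    [(eps2 * kappa) * - (eps1 * kappa)]; [j./2] counts the completed pairs. *)
Lemma helix_nablaT_iter (R : realType) (m t : nat) (c : R) (I : set R)
    (gamma F2 : R -> 'rV[R]_(ambient_dim m c)) (eps1 eps2 kappa : R) (j : nat) :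
  open I -> helix2 t I gamma F2 eps1 eps2 kappa ->
  {in I, nablaT_iter t gamma j =1
    fun s => (- (eps1 * eps2 * kappa ^+ 2)) ^+ j./2 *:
      (if odd j then (eps2 * kappa) *: F2 s else velocity gamma s)}.
Proof.
move=> oI [k [[smg _ _ _] [smF _] _ _ frenet] kE].
elim: j => [|j IHj] s Is; first by rewrite /= scale1r.
rewrite [LHS](eq_nablaT t gamma oI IHj Is) /= uphalf_half.
move/set_mem in Is; have [_ nT nF2] := frenet _ Is; rewrite kE // in nT nF2.
case: (odd j) => /=.
- under [X in nablaT _ _ X]funext => u do rewrite scalerA.
  rewrite nablaTZ ?nF2 ?scalerA; last exact: smF 0%N s Is.
  by congr (_ *: _); rewrite add1n [RHS]exprS; ring.
- by rewrite nablaTZ ?nT //; exact: smooth_on_derive1 smg Is.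
Qed.

Lemma helix_tau (R : realType) (m t r : nat) (c : R) (I : set R)
    (gamma F2 : R -> 'rV[R]_(ambient_dim m c)) (eps1 eps2 kappa s : R) :
  (2 <= r)%N -> open I -> helix2 t I gamma F2 eps1 eps2 kappa -> I s ->
  tau t r gamma s =
    (- (eps1 * kappa * (- (eps1 * eps2 * kappa ^+ 2)) ^+ (r - 2)) *
      (kappa ^+ 2 - eps2 * (r%:R - 1) * c)) *: F2 s.
Proof.
move=> r2 oI hel Is; have Is' := mem_set Is.
have iterE j := helix_nablaT_iter j oI hel Is'.
have [k [[_ _ _ unitT] _ sgn2 unitF2 _] _] := hel.
have := unitT _ Is; rewrite /metric => TT; have [_ TF2] := unitF2 _ Is.
have F2T : semi_euclid (ambient_index t c) (F2 s) (velocity gamma s) = 0.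
  by rewrite semi_euclidC.
have e22 : eps2 ^+ 2 = 1 by case: sgn2 => ->; rewrite ?sqrrN expr1n.
case: r r2 => [//|[//|n _]].
rewrite /tau; set q := - (eps1 * eps2 * kappa ^+ 2) in iterE *.
(* With [r = n + 2] the leading order [2 * n + 3] is odd, so the leading term is
   [q ^+ n.+1 * (eps2 * kappa)] times [F2 s]. *)
have -> : (2 * n.+2 - 1 = n.+1.*2.+1)%N by lia.
have -> : (n.+2 - 1 = n.+1)%N by lia.
have -> : (n.+2 - 2 = n)%N by lia.
rewrite (eq_big_nat _ _
  (F2 := fun=> (c * eps1 * (eps2 * kappa) * q ^+ n) *: F2 s)).
  rewrite sumr_const_nat subn0 iterE /= odd_double uphalf_double /=.
  rewrite !scalerA scalerMnl -scalerDl -mulr_natr.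
  (* By [e22], [q * (eps2 * kappa) = - eps1 * kappa ^+ 3]. *)
  congr (_ *: _); rewrite /q !exprS -/q; ring: e22.
move=> l /andP[_ ln].
have -> : (2 * n.+2 - 3 - l = n.*2.+1 - l)%N by lia.
have /= := odd_double_half l; set h := l./2; case: (odd l) => /= lE; rewrite -lE.
(* Odd [l]: the first argument is along [T], the second along [F2], so only the subtracted term of
   the curvature survives and its sign cancels [(-1) ^+ l]. *)
- have -> : (n.*2.+1 - (1 + h.*2) = (n - h).*2)%N by lia.
  have hn : (h <= n)%N by lia.
  rewrite !iterE add1n /= !odd_double !doubleK uphalf_double /=.
  rewrite /curvature /metric !semi_euclidZl F2T TT -(subnK hn) addnK exprD.
  rewrite exprS -mul2n exprM sqrrN expr1n expr1n.
  rewrite !mulr0 scale0r sub0r scalerN -scaleNr !scalerA.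
  by congr (_ *: _); ring.
(* Even [l]: the roles are exchanged and both signs are positive. *)
- have -> : (n.*2.+1 - (0 + h.*2) = (n - h).*2.+1)%N by lia.
  have hn : (h <= n)%N by lia.
  rewrite !iterE add0n /= !odd_double !doubleK uphalf_double /=.
  rewrite /curvature /metric !semi_euclidZl F2T TT -(subnK hn) addnK exprD.
  rewrite -mul2n exprM sqrrN !expr1n.
  rewrite !mulr0 scale0r subr0 !scalerA.
  by congr (_ *: _); ring.
Qed.

Theorem theorem1p7 (R : realType) (m t r : nat) (c : R) (I : set R)
    (gamma F2 : R -> 'rV[R]_(ambient_dim m c)) (eps1 eps2 kappa : R) :
  (2 <= r)%N -> (3 <= m)%N -> (1 <= t <= m - 1)%N ->
  open I -> is_interval I -> I !=set0 ->
  helix2 t I gamma F2 eps1 eps2 kappa ->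
  (proper_harmonic t r I gamma <->
   kappa ^+ 2 - eps2 * (r%:R - 1) * c = 0).
Proof.
move=> r2 _ _ oI _ [s0 Is0] hel.
have [k [[_ _ sgn1 _] _ sgn2 unitF2 frenet] kE] := hel.
have e10 : eps1 != 0 by case: sgn1 => ->; rewrite ?oppr_eq0 oner_eq0.
have e20 : eps2 != 0 by case: sgn2 => ->; rewrite ?oppr_eq0 oner_eq0.
have [k0 nT _] := frenet _ Is0; rewrite kE // in k0 nT.
have kappa0 : kappa != 0 by rewrite gt_eqF.
(* The metric is indefinite, but [F2 s0] has square norm [eps2], which is nonzero. *)
have F20 : F2 s0 != 0.
  apply/eqP => F20; have [] := unitF2 _ Is0; rewrite F20 /metric semi_euclid0l.
  by move=> /esym /eqP; rewrite (negPf e20).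
split=> [[harm _]|eq0].
  (* The coefficient of [F2] is constant along the curve, so the single point [s0] suffices. *)
  have /eqP := harm _ Is0; rewrite (helix_tau r2 oI hel Is0) scaler_eq0.
  rewrite (negPf F20) orbF mulf_eq0 => /orP[|/eqP //].
  rewrite oppr_eq0 (negPf (_ : _ != 0)) //.
  by rewrite !mulf_neq0 ?expf_neq0 ?oppr_eq0 ?mulf_neq0 ?expf_neq0.
split=> [s Is|/(_ _ Is0)/eqP].
  by rewrite (helix_tau r2 oI hel Is) eq0 mulr0 scale0r.
(* Not a geodesic: [eps2 * kappa] and [F2 s0] are both nonzero. *)
by rewrite nT scaler_eq0 mulf_eq0 (negPf e20) (negPf kappa0) (negPf F20).
Qed.
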